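(* Let $q$ be a prime power, $b\ge 1$ an integer, and $k$ a positive integer with $k\geq b$. Let $\gamma$ be a primitive element of $\mathbb{F}_{q^k}$. Let $$\widetilde{\mathcal{C}}=\left\{\widetilde{\mathbf{c}}_{g,y}=\left(\left(\mathrm{Tr}_{q^k/q}\left(g\,\gamma^{i}\right)+y\right)_{i=0}^{q^k-2},\,y\right): g\in\mathbb{F}_{q^k}\text{ and }y\in\mathbb{F}_q\right\}\subseteq\mathbb{F}_q^{q^k}.$$ Then $\widetilde{\mathcal{C}}$ is a $\left(q^k,\;k+1,\;q^k-q^{k-b}\right)^b_q$ linear code, and it is distance-optimal with respect to the $b$-symbol Griesmer bound.
   Context: $\mathrm{Tr}_{q^k/q}(x)=x+x^q+\cdots+x^{q^{k-1}}$ is the trace from $\mathbb{F}_{q^k}$ to $\mathbb{F}_q$; a primitive element is a generator of the multiplicative group $\mathbb{F}_{q^k}^*$. Each codeword $\widetilde{\mathbf{c}}_{g,y}$ has $q^k$ coordinates, the last one (position $q^k-1$) being $y$. For $\mathbf{a},\mathbf{c}\in\mathbb{F}_q^n$, the $b$-symbol distance is $d_b(\mathbf{a},\mathbf{c})=|\{0\le i\le n-1:(a_i,\ldots,a_{i+b-1})\neq(c_i,\ldots,c_{i+b-1})\}|$, with subscripts taken modulo $n$. An $(n,k',d_b)^b_q$ linear code is a $k'$-dimensional $\mathbb{F}_q$-subspace of $\mathbb{F}_q^n$ whose minimum $b$-symbol distance between distinct codewords equals $d_b$. The $b$-symbol Griesmer bound for an $(n,k',d_b)^b_q$ linear code is $$\frac{(q^b-1)n}{q-1}\ge\sum_{i=0}^{k'-1}\left\lceil\frac{q^{b-1}d_b}{q^i}\right\rceil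 .$$ An $(n,k',d_b)^b_q$ linear code is distance-optimal with respect to this bound if the bound rules out an $(n,k',d_b+1)^b_q$ linear code, i.e. if the inequality fails when $d_b$ is replaced by $d_b+1$ (in particular no $(n,k',d_b+1)^b_q$ linear code exists). *)

(* Defs.v *)
From mathcomp Require Import all_boot all_order all_algebra.
From mathcomp Require Import all_fingroup all_solvable all_field.

Set Implicit Arguments.
Unset Strict Implicit.
Unset Printing Implicit Defensive.

Import Order.TTheory GRing.Theory Num.Theory.

Local Open Scope ring_scope.

(* The extension F_{q^k} / F_q is a pair of finite fields F, L with an
   embedding iota : F -> L and #|L| = #|F| ^ k.  The sum x + x^q + ... +
   x^(q^(k-1)) lies in the image of F, so its value in F is obtained by
   inverting iota; the default 0 is never used, see ffield_traceE. *)
Definition ffield_trace (F L : finFieldType) (iota : {rmorphism F -> L})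
    (k : nat) (x : L) : F :=
  odflt 0 [pick y : F | iota y == \sum_(j < k) x ^+ (#|F| ^ j)%N].

Lemma ffield_traceE (F L : finFieldType) (iota : {rmorphism F -> L})
    (k : nat) (x : L) :
  #|L| = (#|F| ^ k)%N ->
  iota (ffield_trace iota k x) = \sum_(j < k) x ^+ (#|F| ^ j)%N.
Proof.
move=> cardL; rewrite /ffield_trace; case: pickP => [y /eqP // | none].
set t := \sum_(j < k) _ in none *; exfalso.
have q_gt1 : (1 < #|F|)%N := finNzRing_gt1 F.
have pcharL : [pchar L].-nat #|F|.
  have [p p_pr pF] := finPcharP F.
  have pL : p \in [pchar L] by rewrite (fmorph_pchar iota).
  rewrite (card_pprimeChar pF) pnatX; apply/orP; left.
  by rewrite pnatE.
have exprqD (u v : L) : (u + v) ^+ #|F| = u ^+ #|F| + v ^+ #|F|.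
  exact: exprDn_pchar.
have tq : t ^+ #|F| = t.
  have -> : t ^+ #|F| = \sum_(j < k) x ^+ (#|F| ^ j.+1)%N.
    have expq0 : (0 : L) ^+ #|F| = 0 by rewrite expr0n; case: #|F| q_gt1.
    rewrite (big_morph (fun u : L => u ^+ #|F|) exprqD expq0).
    by apply: eq_bigr => j _; rewrite -exprM expnSr.
  have := cardL; rewrite /t; case: (k) => [|m] cardL'; first by rewrite !big_ord0.
  rewrite big_ord_recr [RHS]big_ord_recl /= -cardL' expf_card.
  by rewrite expn0 expr1 addrC.
have : root ('X^#|F| - 'X : {poly L}) t.
  by rewrite rootE !hornerE tq subrr.
have -> : 'X^#|F| - 'X = map_poly iota ('X^#|F| - 'X : {poly F}).
  by rewrite rmorphB /= map_polyXn map_polyX.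
rewrite finField_genPoly rmorph_prod /=.
under eq_bigr do rewrite map_polyXsubC.
by rewrite rootE horner_prod => /prodf_eq0[y _];
  rewrite !hornerE subr_eq0 eq_sym none.
Qed.

Lemma val_iter_ordS (n j : nat) (i : 'I_n) :
  iter j (@ordS n) i = ((i + j) %% n)%N :> nat.
Proof.
elim: j => [|j IHj] /=; first by rewrite addn0 modn_small.
by rewrite IHj -addn1 modnDml addn1 addnS.
Qed.

(* (c_i, ..., c_(i+b-1)) with subscripts modulo n, ordS being the cyclic
   successor on 'I_n (val_iter_ordS). *)
Definition bsymbol (F : Type) (b n : nat) (c : 'rV[F]_n) (i : 'I_n) :
    'rV[F]_b :=
  \row_(j < b) c 0 (iter j (@ordS n) i).

Definition bdist (F : eqType) (b n : nat) (a c : 'rV[F]_n) : nat :=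
  #|[set i : 'I_n | bsymbol b a i != bsymbol b c i]|.

Definition is_linear_bcode (F : finFieldType) (b n k' d : nat)
    (C : {set 'rV[F]_n}) : Prop :=
  [/\ exists2 V : {vspace 'rV[F]_n}, C =i V & \dim V = k',
      exists a c : 'rV[F]_n, [/\ a \in C, c \in C, a != c & bdist b a c = d]
    & forall a c : 'rV[F]_n,
        a \in C -> c \in C -> a != c -> (d <= bdist b a c)%N].

Definition bgriesmer_bound (q b n k' d : nat) : Prop :=
  \sum_(i < k') (Num.ceil (q%:R ^+ b.-1 * d%:R / q%:R ^+ i : rat))%:~R
    <= (q%:R ^+ b - 1) * n%:R / (q%:R - 1) :> rat.

Definition bgriesmer_distance_optimal (F : finFieldType) (b n k' d : nat)
    (C : {set 'rV[F]_n}) : Prop :=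
  is_linear_bcode b k' d C /\ ~ bgriesmer_bound #|F| b n k' d.+1.

Definition ext_codeword (F L : finFieldType) (iota : {rmorphism F -> L})
    (n k : nat) (gamma g : L) (y : F) : 'rV[F]_n :=
  \row_(i < n) if (i < n.-1)%N then ffield_trace iota k (g * gamma ^+ i) + y
               else y.

Definition ext_code (F L : finFieldType) (iota : {rmorphism F -> L})
    (n k : nat) (gamma : L) : {set 'rV[F]_n} :=
  [set ext_codeword iota n k gamma g y | g : L, y : F].

(* Main.v *)
(* Since 1, gamma, ..., gamma^(k-1) is a basis of L over F and the trace form is
   nondegenerate, for g != 0 the map x |-> (Tr(g x gamma^j))_(j<k) is a bijection
   L -> F^k, so exactly q^(k-b) elements x have a prescribed window
   (Tr(g x gamma^j))_(j<b).  The zero windows of a nonzero codeword inject into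
   such a set: for y != 0 they avoid the last coordinate, and i |-> gamma^i does;
   for y = 0 at most one of them does not come from a zero window of the periodic
   sequence Tr(g gamma^m), and it is sent to the element 0.  Hence all weights are
   at least q^k - q^(k-b), with equality when the first b - 1 coordinates vanish
   and y = 0. *)

Require Import Defs.
From mathcomp Require Import all_boot all_order all_algebra.
From mathcomp Require Import all_fingroup all_solvable all_field.
From mathcomp Require Import zify ring lra.

Set Implicit Arguments.
Unset Strict Implicit.
Unset Printing Implicit Defensive.

Import Order.TTheory GRing.Theory Num.Theory.

Local Open Scope ring_scope.

(** * Linearity and nondegeneracy of the trace *)

Section Trace.

Variables (F L : finFieldType) (iota : {rmorphism F -> L}) (k : nat).
Hypothesis cardL : #|L| = (#|F| ^ k)%N.

Local Notation tr := (ffield_trace iota k).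

Lemma expf_card_iter (a : F) j : a ^+ (#|F| ^ j)%N = a.
Proof. by elim: j => [|j IHj]; rewrite ?expr1 // expnSr exprM IHj expf_card. Qed.

Lemma pchar_nat_card j : [pchar L].-nat (#|F| ^ j)%N.
Proof.
have [p p_pr pF] := finPcharP F.
have pL : p \in [pchar L] by rewrite (fmorph_pchar iota).
by rewrite (card_pprimeChar pF) -expnM pnatX pnatE // pL.
Qed.

(** The exponents in the trace are powers of the characteristic, so each summand is additive, and
    each fixes the scalars from [F]. *)
Lemma ffield_traceP a x y : tr (iota a * x + y) = a * tr x + tr y.
Proof.
apply: (fmorph_inj iota); rewrite rmorphD rmorphM !ffield_traceE //.
rewrite mulr_sumr -big_split /=; apply: eq_bigr => j _.
by rewrite exprDn_pchar ?pchar_nat_card // exprMn -rmorphXn expf_card_iter.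
Qed.

Lemma ffield_trace0 : tr 0 = 0.
Proof.
have := ffield_traceP 1 0 0; rewrite rmorph1 !mul1r addr0 => /eqP.
by rewrite eq_sym -subr_eq0 addrK => /eqP.
Qed.

Lemma ffield_traceD x y : tr (x + y) = tr x + tr y.
Proof. by have := ffield_traceP 1 x y; rewrite rmorph1 !mul1r. Qed.

Lemma ffield_traceZ a x : tr (iota a * x) = a * tr x.
Proof. by have := ffield_traceP a x 0; rewrite ffield_trace0 !addr0. Qed.

Lemma ffield_traceB x y : tr (x - y) = tr x - tr y.
Proof.
by have := ffield_traceZ (-1) y; rewrite rmorphN1 !mulN1r ffield_traceD => ->.
Qed.

Lemma ffield_trace_sum (I : finType) (f : I -> L) :
  tr (\sum_i f i) = \sum_i tr (f i).
Proof. exact: (big_morph _ ffield_traceD ffield_trace0). Qed.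

(** The trace is given by a polynomial of degree at most q^(k-1). Its coefficient of X is 1, so it
    is nonzero and cannot vanish at all q^k elements of [L]. *)
Lemma ffield_trace_neq0 : exists z, tr z != 0.
Proof.
have q_gt1 : (1 < #|F|)%N := finNzRing_gt1 F.
apply/existsP; apply: contraT; rewrite negb_exists => /forallP tr0.
have L_gt1 : (1 < #|L|)%N := finNzRing_gt1 L.
pose P : {poly L} := \sum_(j < k) 'X^(#|F| ^ j)%N.
have k_gt0 : (0 < k)%N by move: L_gt1; rewrite cardL; case: (k).
have P_neq0 : P != 0.
  apply/eqP => /(congr1 (fun p : {poly L} => p`_1)) /eqP.
  rewrite coef_sum coef0 (bigD1 (Ordinal k_gt0)) //= coefXn expn0 eqxx.
  rewrite big1 ?addr0 ?oner_eq0 // => j; rewrite -val_eqE /= => j_neq0.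
  by rewrite coefXn eq_sym -[1%N](expn0 #|F|) eqn_exp2l // (negbTE j_neq0).
have P_root x : root P x.
  rewrite rootE horner_sum; under eq_bigr do rewrite hornerXn.
  by rewrite -(ffield_traceE iota) //; have /negPn/eqP -> := tr0 x; rewrite rmorph0.
have := max_poly_roots P_neq0 (introT allP (fun x _ => P_root x)) (enum_uniq L).
rewrite -cardE cardL => lt_size.
have : (size P <= (#|F| ^ k.-1).+1)%N.
  apply: leq_trans (size_sum _ _ _) _; apply/bigmax_leqP => j _.
  by rewrite size_polyXn ltnS leq_pexp2l ?(ltnW q_gt1) // -ltnS prednK.
move=> /(leq_trans lt_size); rewrite ltnS leq_exp2l //.
by rewrite leqNgt prednK ?leqnn.
Qed.

Lemma ffield_trace_nondegenerate w : (forall z, tr (w * z) = 0) -> w = 0.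
Proof.
move=> trw0; have [z] := ffield_trace_neq0; apply: contraNeq => w_neq0.
by have := trw0 (w^-1 * z); rewrite mulVKf // => ->.
Qed.

(** * Powers of a primitive element and trace windows *)

Variable gamma : {unit L}.
Hypothesis gamma_primitive : generator [set: {unit L}] gamma.
Local Notation gam := (val gamma).

Lemma order_primitive : #[gamma]%g = #|L|.-1.
Proof.
by rewrite -card_finField_unit (eqP gamma_primitive).
Qed.

Lemma primitive_powerP x : x != 0 -> exists2 m, (m < #|L|.-1)%N & x = gam ^+ m.
Proof.
move=> x_neq0; have Ux : x \is a GRing.unit by rewrite unitfE.
have : FinRing.unit L Ux \in <[gamma]>%g by rewrite -(eqP gamma_primitive) inE.
case/cyclePmin => m; rewrite order_primitive => lt_m /(congr1 val) /= Ex.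
by exists m; rewrite // Ex; exact: FinRing.val_unitX.
Qed.

Lemma primitive_power_inj m n : (m < #|L|.-1)%N -> (n < #|L|.-1)%N ->
  gam ^+ m = gam ^+ n -> m = n.
Proof.
rewrite -order_primitive => lt_m lt_n; rewrite -!FinRing.val_unitX => /val_inj /eqP.
by rewrite eq_expg_mod_order !modn_small // => /eqP.
Qed.

Lemma primitive_power_period m : gam ^+ (m + #|L|.-1) = gam ^+ m.
Proof.
by rewrite exprD -order_primitive -!FinRing.val_unitX expg_order /= mulr1.
Qed.

(** The length is left free: it is [k] for coordinates on [L], and the degree of a supposed relation
    in [primitive_eval_inj]. *)
Let ev n (v : 'rV[F]_n) : L := (map_poly iota (rVpoly v)).[gam].

Let evE n (v : 'rV[F]_n) : ev v = \sum_(j < n) iota (v 0 j) * gam ^+ j.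
Proof.
rewrite /ev (@horner_coef_wide _ n) ?size_map_poly ?size_poly //.
by apply: eq_bigr => j _; rewrite coef_map coef_rVpoly_ord.
Qed.

(* If gamma were a root of a nonzero p of degree d < k over F, reducing powers
   of gamma modulo p would leave at most q ^ d elements in L. *)
Lemma primitive_eval_inj : injective (@ev k).
Proof.
move=> u v Euv; apply/eqP; rewrite -subr_eq0; apply: contraT => uv_neq0.
have q_gt1 : (1 < #|F|)%N := finNzRing_gt1 F.
pose p := rVpoly (u - v).
have p_neq0 : p != 0.
  apply: contra uv_neq0 => /eqP p0.
  by rewrite -[u - v]rVpolyK -/p p0 linear0.
have p_root : (map_poly iota p).[gam] = 0.
  by rewrite /p linearB rmorphB /= hornerD hornerN; move: Euv; rewrite /ev => ->;
     rewrite subrr.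
have d_lt_k : ((size p).-1 < k)%N.
  by rewrite prednK ?lt0n ?size_poly_eq0 // size_poly.
have ev_surj x : exists w, x = @ev (size p).-1 w.
  have [->|/primitive_powerP [m _ ->]] := eqVneq x 0.
    by exists 0; rewrite /ev linear0 rmorph0 horner0.
  exists (poly_rV ('X^m %% p)); rewrite /ev poly_rV_K; last first.
    by rewrite -ltnS prednK ?lt0n ?size_poly_eq0 // ltn_modp.
  have := congr1 (fun r => (map_poly iota r).[gam]) (divp_eq 'X^m p).
  by rewrite map_polyXn hornerXn rmorphD rmorphM /= hornerD hornerM p_root mulr0 add0r.
have : (#|L| <= #|{: 'rV[F]_(size p).-1}|)%N.
  apply: leq_trans (leq_image_card (@ev (size p).-1) predT).
  apply/subset_leq_card/subsetP => x _; have [w ->] := ev_surj x.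
  exact: codom_f.
by rewrite cardL card_mx mul1n leq_exp2l // leqNgt d_lt_k.
Qed.

(** By counting, [ev] is bijective in length [k], so the first [k] powers of [gam] span [L]. Equal
    coordinates thus make [g * (x - y)] orthogonal to all of [L] under the trace form. *)
Lemma ffield_trace_coords_inj g : g != 0 ->
  injective (fun x => \row_(j < k) tr (g * x * gam ^+ j)).
Proof.
move=> g_neq0 x y /rowP Exy; apply/eqP; rewrite -subr_eq0.
suff /eqP : g * (x - y) = 0 by rewrite mulf_eq0 (negPf g_neq0).
apply: ffield_trace_nondegenerate => z.
have [u _ uK] : bijective (@ev k).
  by apply: inj_card_bij primitive_eval_inj _; rewrite cardL card_mx mul1n.
rewrite -[z]uK evE mulr_sumr ffield_trace_sum big1 // => j _.
rewrite mulrCA ffield_traceZ mulrBr mulrBl ffield_traceB.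
by have := Exy j; rewrite !mxE => ->; rewrite subrr mulr0.
Qed.

(** The coordinate map is a bijection from [L] to vectors of length [b + m]; fixing the left block
    leaves the right block of length [m = k - b] free. *)
Lemma card_ffield_trace_window (b : nat) (g : L) (c : 'rV[F]_b) :
  (b <= k)%N -> g != 0 ->
  #|[set x | [forall j : 'I_b, tr (g * x * gam ^+ j) == c 0 j]]| =
    (#|F| ^ (k - b))%N.
Proof.
move=> b_le_k /ffield_trace_coords_inj.
move Dm: (k - b)%N => m; have Ek : k = (b + m)%N by rewrite -Dm subnKC.
set phi := (fun x => _) => phi_inj.
pose psi x : 'rV[F]_(b + m) := castmx (erefl 1%N, Ek) (phi x).
have psi_inj : injective psi.
  by move=> x y /(can_inj (castmxK _ _)) /phi_inj.
have [u uK psiK] : bijective psi.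
  by apply: inj_card_bij psi_inj _; rewrite cardL card_mx mul1n Ek.
have -> : [set x | [forall j : 'I_b, tr (g * x * gam ^+ j) == c 0 j]] =
          [set u (row_mx c w) | w : 'rV_m].
  apply/setP=> x; rewrite inE; have lsubE j :
      lsubmx (psi x) 0 j = tr (g * x * gam ^+ j).
    by rewrite !mxE castmxE !mxE.
  apply/forallP/imsetP => [xc | [w _ xw] j].
    exists (rsubmx (psi x)) => //; rewrite -[LHS]uK; congr u.
    rewrite -[LHS]hsubmxK; congr row_mx; apply/rowP=> j.
    by rewrite lsubE; apply/eqP/xc.
  by rewrite -lsubE xw psiK row_mxKl.
rewrite card_imset ?card_mx ?mul1n // => v w /(can_inj psiK).
by move/eq_row_mx => [].
Qed.

End Trace.

(** * Distances through zero windows, and subspaces from closed sets *)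

Lemma bdistE (R : zmodType) (b n : nat) (a c : 'rV[R]_n) :
  bdist b a c = (n - #|[set i | bsymbol b (a - c) i == 0%R]|)%N.
Proof.
rewrite /bdist cardsCs card_ord; congr (_ - _)%N; apply: eq_card => i.
rewrite !inE negbK -subr_eq0; congr (_ == _).
by apply/rowP=> j; rewrite !mxE.
Qed.

(** With [s] the enumeration of a code, this provides the vector space required by
    [is_linear_bcode]. *)
Lemma linear_closed_vspace (F : finFieldType) (vT : vectType F) (C : {pred vT}) :
  0 \in C -> (forall a u v, u \in C -> v \in C -> a *: u + v \in C) ->
  forall s : seq vT, (forall u, (u \in s) = (u \in C)) -> C =i <<s>>%VS.
Proof.
move=> C0 C_lin s sC v; apply/idP/idP => [vC | /(coord_span (X := in_tuple s)) ->].
  by rewrite memv_span // sC.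
elim/big_ind: _ => // [u w uC wC | i _].
  by rewrite -[u]scale1r C_lin.
by rewrite -[_ *: _]addr0 C_lin // -sC mem_nth.
Qed.

(** * Zero windows of the codewords *)

Section Code.

Variables (F L : finFieldType) (iota : {rmorphism F -> L}) (b k n : nat).
Variable gamma : {unit L}.
Hypotheses (cardL : #|L| = (#|F| ^ k)%N) (cardn : #|L| = n).
Hypotheses (b_gt0 : (0 < b)%N) (b_le_k : (b <= k)%N).
Hypothesis gamma_primitive : generator [set: {unit L}] gamma.

Local Notation tr := (ffield_trace iota k).
Local Notation gam := (val gamma).
Local Notation cw := (ext_codeword iota n k gam).

Let s g m := tr (g * gam ^+ m).
Let entry g y m : F := if (m < n.-1)%N then s g m + y else y.
Local Notation zeros c := [set i | bsymbol b c i == 0].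

Let q_gt1 : (1 < #|F|)%N := finNzRing_gt1 F.

Let n_gt1 : (1 < n)%N.
Proof. by rewrite -cardn; exact: finNzRing_gt1. Qed.

Let b_lt_n : (b < n)%N.
Proof. by rewrite -cardn cardL; exact: leq_ltn_trans b_le_k (ltn_expl k q_gt1). Qed.

Lemma ext_codewordP a g y g' y' :
  cw (iota a * g + g') (a * y + y') = a *: cw g y + cw g' y'.
Proof.
apply/rowP=> i; rewrite !mxE; case: ifP => _ //.
by rewrite mulrDl -mulrA (ffield_traceP _ cardL); ring.
Qed.

Lemma ext_codeword0 : cw 0 0 = 0.
Proof.
apply/rowP=> i; rewrite !mxE mul0r (ffield_trace0 _ cardL) addr0.
by case: ifP.
Qed.

Lemma ext_codewordB g y g' y' : cw g y - cw g' y' = cw (g - g') (y - y').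
Proof.
have := ext_codewordP (-1) g' y' g y.
rewrite rmorphN1 scaleN1r !mulN1r => E; rewrite [LHS]addrC -E.
by congr ext_codeword; rewrite addrC.
Qed.

Let zerosP g y (i : 'I_n) :
  reflect (forall j, (j < b)%N -> entry g y ((i + j) %% n) = 0)
          (i \in zeros (cw g y)).
Proof.
rewrite inE; apply: (iffP eqP) => [/rowP i0 j lt_j | i0].
  by have := i0 (Ordinal lt_j); rewrite !mxE val_iter_ordS.
by apply/rowP=> j; rewrite !mxE val_iter_ordS; exact: i0.
Qed.

Let s_period g m : s g (m + n.-1) = s g m.
Proof. by rewrite /s -cardn primitive_power_period. Qed.

Let entry_lt g y m : (m < n.-1)%N -> entry g y (m %% n) = s g m + y.
Proof. by move=> lt_m; rewrite modn_small ?/entry ?lt_m //; lia. Qed.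

Let entry_last g y : entry g y (n.-1 %% n) = y.
Proof. by rewrite modn_small ?/entry ?ltnn //; lia. Qed.

(** Past the extra coordinate, a cyclic window resumes the sequence of period [n.-1] with a delay of
    one index. *)
Let entry_wrap g y m : (n.-1 <= m < 2 * n.-1)%N ->
  entry g y (m.+1 %% n) = s g m + y.
Proof.
move=> m_bnd; have -> : m.+1 = (m - n.-1 + n)%N by lia.
rewrite modnDr entry_lt; last by lia.
by rewrite -s_period subnK //; lia.
Qed.

(** The prescribed value is [- y] because a coordinate other than the extra one is a trace plus
    [y]. *)
Let window g y :=
  [set x | [forall j : 'I_b, tr (g * x * gam ^+ j) == - y]].

Let card_window g y : g != 0 -> #|window g y| = (#|F| ^ (k - b))%N.
Proof.
move=> g_neq0.
rewrite -(card_ffield_trace_window iota cardL gamma_primitive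
            (const_mx (- y)) b_le_k g_neq0).
by apply: eq_card => x; rewrite !inE; apply: eq_forallb => j; rewrite mxE.
Qed.

Let windowP g y i :
  reflect (forall j, (j < b)%N -> s g (i + j) = - y) (gam ^+ i \in window g y).
Proof.
rewrite inE; apply: (iffP forallP) => [xi j lt_j | xi j].
  by have /eqP := xi (Ordinal lt_j); rewrite -mulrA -exprD.
by rewrite -mulrA -exprD; apply/eqP/xi.
Qed.

Let power_inj i j : (i < n.-1)%N -> (j < n.-1)%N -> gam ^+ i = gam ^+ j -> i = j.
Proof. by rewrite -cardn; exact: primitive_power_inj. Qed.

Let s0 m : s 0 m = 0.
Proof. by rewrite /s mul0r (ffield_trace0 _ cardL). Qed.

(** The extra coordinate carries [y != 0], so a zero window ends before it and never wraps
    around. *)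
Let zeros_sub_window g y i : y != 0 -> i \in zeros (cw g y) ->
  (i < n.-1)%N /\ gam ^+ i \in window g y.
Proof.
move=> y_neq0 /zerosP iz.
have lt_ij j : (j < b)%N -> (i + j < n.-1)%N.
  move=> lt_j; rewrite ltnNge; apply: contra y_neq0 => le_ij.
  have := iz (n.-1 - i)%N; rewrite subnKC ?entry_last; last by case: (i) => /=; lia.
  by move=> -> //; lia.
split; first by have := lt_ij 0%N b_gt0; rewrite addn0.
apply/windowP=> j lt_j; have := iz j lt_j; rewrite entry_lt ?lt_ij // => /eqP.
by rewrite addr_eq0 => /eqP.
Qed.

(* Sends the zero windows of c_(g,0) into the b-symbol zeros of the periodic
   sequence Tr(g gamma^m); 0 is left free for the one zero window that the extra
   coordinate may create. *)
Let lift_window g (i : 'I_n) : L :=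
  if (i < n.-1)%N && (gam ^+ i \in window g 0) then gam ^+ i else 0.

Let window0 g : 0 \in window g 0.
Proof.
rewrite inE; apply/forallP=> j.
by rewrite mulr0 mul0r (ffield_trace0 _ cardL) oppr0.
Qed.

(* A zero window of c_(g,0) across the extra coordinate shows only b - 1
   consecutive terms of the sequence; the missing one is read off from the later
   zero window i'. *)
Let zeros_window_lt g (i i' : 'I_n) : i \in zeros (cw g 0) -> i' \in zeros (cw g 0) ->
  (i < i')%N -> (i < n.-1)%N && (gam ^+ i \in window g 0).
Proof.
move=> /zerosP iz /zerosP iz' lt_i; have lt_i' := ltn_ord i'.
apply/andP; split; first by lia.
apply/windowP=> j lt_j; rewrite oppr0.
have [lt_ij | le_ij] := ltnP (i + j) n.-1.
  by have := iz j lt_j; rewrite entry_lt // addr0.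
have [lt_j1 | le_j1] := ltnP j.+1 b.
  by have := iz _ lt_j1; rewrite addnS entry_wrap ?addr0 //; lia.
(* Now [j.+1 = b], and the missing term sits at coordinate [i + b]. The window of [i'] covers it
   because [i < i' <= n.-1 <= i + j]. *)
have := iz' (i + j.+1 - i')%N; rewrite subnKC; last by lia.
by rewrite addnS entry_wrap ?addr0; [apply; lia | lia].
Qed.

Let gam_neq0 : gam != 0.
Proof. by rewrite -unitfE; exact: (valP gamma). Qed.

(** Of two distinct zero windows, the earlier is sent to a power of [gam] by [zeros_window_lt], so
    at most one zero window is sent to 0. *)
Let lift_window_inj g : {in zeros (cw g 0) &, injective (lift_window g)}.
Proof.
have wlog_inj (i i' : 'I_n) : i \in zeros (cw g 0) -> i' \in zeros (cw g 0) ->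
    (i < i')%N -> lift_window g i = lift_window g i' -> False.
  move=> iz i'z lt_i; rewrite /lift_window (zeros_window_lt iz i'z lt_i).
  have lt_i' := ltn_ord i'.
  case: ifP => [/andP[lt_n _] /power_inj E | _ /eqP].
    by have := E _ lt_n; lia.
  by rewrite expf_eq0 (negPf gam_neq0) andbF.
move=> i i' iz i'z E; have [lt|lt|] := ltngtP i i'; last exact: ord_inj.
  by case: (wlog_inj i i').
by case: (wlog_inj i' i).
Qed.

Lemma card_zeros_ext_codeword g y : (g, y) != (0, 0) ->
  (#|zeros (cw g y)| <= #|F| ^ (k - b))%N.
Proof.
rewrite xpair_eqE; have [-> | y_neq0] := eqVneq y 0.
  rewrite andbT => g_neq0; rewrite -(card_window 0 g_neq0).
  rewrite -(card_in_imset (@lift_window_inj g)); apply/subset_leq_card/subsetP=> x.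
  by case/imsetP=> i _ ->; rewrite /lift_window; case: ifP => [/andP[]|_].
move=> _; have [-> | g_neq0] := eqVneq g 0.
  rewrite (_ : zeros _ = set0) ?cards0 //; apply/setP=> i; rewrite in_set0.
  apply/negP => /(zeros_sub_window y_neq0) [_ /windowP /(_ _ b_gt0) /eqP].
  by rewrite s0 eq_sym oppr_eq0 (negPf y_neq0).
rewrite -(card_window y g_neq0) -(@card_in_imset _ _ (fun i : 'I_n => gam ^+ i)).
  apply/subset_leq_card/subsetP=> x /imsetP [i iz ->].
  by have [] := zeros_sub_window y_neq0 iz.
move=> i i' /(zeros_sub_window y_neq0) [lt_i _] /(zeros_sub_window y_neq0) [lt_i' _].
by move=> /(power_inj lt_i lt_i') /val_inj.
Qed.

(* g is chosen so that the first b - 1 coordinates of c_(g,0) vanish, whence the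
   window starting at the extra coordinate is zero. *)
Lemma ext_codeword_many_zeros :
  exists2 g, g != 0 & #|zeros (cw g 0)| = (#|F| ^ (k - b))%N.
Proof.
(* The first [b] traces are prescribed as (0, ..., 0, 1); the final 1 forces [g != 0]. *)
have [g g_s] : exists g, forall j : 'I_b, s g j = (j == b.-1 :> nat)%:R.
  pose c : 'rV[F]_b := \row_j (j == b.-1 :> nat)%:R.
  have := card_ffield_trace_window iota cardL gamma_primitive c b_le_k (oner_neq0 L).
  set T := [set _ | _] => cardT; have /card_gt0P[g] : (0 < #|T|)%N.
    by rewrite cardT expn_gt0 ltnW.
  rewrite inE => /forallP gT; exists g => j; have /eqP := gT j.
  by rewrite mxE mul1r.
have g_neq0 : g != 0.
  have lt_b : (b.-1 < b)%N by lia.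
  apply: contraPneq (g_s (Ordinal lt_b)) => ->; rewrite s0 eqxx => /eqP.
  by rewrite eq_sym oner_eq0.
exists g => //; apply/eqP; rewrite eqn_leq.
rewrite card_zeros_ext_codeword ?xpair_eqE ?(negPf g_neq0) //=.
(* It remains to see that [lift_window] reaches all of [window g 0]: 0 comes from the window at the
   extra coordinate, and [gam ^+ m] from the window at [m]. *)
rewrite -(card_window 0 g_neq0) -(card_in_imset (@lift_window_inj g)).
apply/subset_leq_card/subsetP=> x xT.
have [x0 | /(primitive_powerP gamma_primitive) [m]] := eqVneq x 0.
  have lt_n : (n.-1 < n)%N by lia.
  apply/imsetP; exists (Ordinal lt_n); last by rewrite /lift_window ltnn.
  apply/zerosP => -[|j] lt_j; first by rewrite addn0 entry_last.
  rewrite addnS entry_wrap /=; last by lia.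
  rewrite addr0 addnC s_period; have lt_jb : (j < b)%N by lia.
  by rewrite (g_s (Ordinal lt_jb)) /= (_ : (j == b.-1) = false) //; lia.
rewrite cardn => lt_m xm; have lt_mn : (m < n)%N by lia.
apply/imsetP; exists (Ordinal lt_mn); last by rewrite /lift_window /= lt_m -xm xT.
move: xT; rewrite xm => /windowP xT; apply/zerosP => j lt_j /=.
have [lt_mj | ] := ltnP (m + j) n.-1.
  by rewrite entry_lt // xT // oppr0 addr0.
rewrite leq_eqVlt => /predU1P [<- | lt_mj]; first exact: entry_last.
have -> : (m + j = (m + j.-1).+1)%N by lia.
by rewrite entry_wrap ?xT ?oppr0 ?addr0 //; lia.
Qed.

(** * Parameters of the code *)

Let zeros_bound : (#|F| ^ (k - b) < n)%N.
Proof. by rewrite -cardn cardL ltn_exp2l //; lia. Qed.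

(** Equal codewords have difference zero, with [n] zero windows; distinct parameters would allow at
    most q^(k-b) < n of them. *)
Lemma ext_codeword_inj g y g' y' : cw g y = cw g' y' -> (g, y) = (g', y').
Proof.
move=> E; apply/eqP; rewrite xpair_eqE -subr_eq0 -[y == y']subr_eq0 -xpair_eqE.
apply: contraT => /card_zeros_ext_codeword.
rewrite -ext_codewordB E subrr (_ : zeros 0 = setT) ?cardsT ?card_ord.
  by rewrite leqNgt zeros_bound.
by apply/setP=> i; rewrite !inE; apply/eqP/rowP=> j; rewrite !mxE.
Qed.

Lemma ext_code_linear_bcode :
  is_linear_bcode b k.+1 (n - #|F| ^ (k - b))%N (ext_code iota n k gam).
Proof.
set C := ext_code _ _ _ _.
have C_cw g y : cw g y \in C by apply/imset2P; exists g y.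
split.
- have CV : C =i <<enum C>>%VS.
    apply: (@linear_closed_vspace _ _ (mem C)) => [|a u v|u]; last exact: mem_enum.
      by rewrite -ext_codeword0 C_cw.
    case/imset2P=> g y _ _ -> /imset2P[g' y' _ _ ->].
    by rewrite -ext_codewordP C_cw.
  (* The dimension is read off from the cardinality q^(k+1), as the pairs [(g, y)] parametrize the
     code injectively. *)
  exists <<enum C>>%VS => //; apply: (expnI q_gt1); rewrite -card_vspace.
  transitivity #|C|; first by apply: eq_card => v; rewrite -CV.
  have -> : C = [set cw p.1 p.2 | p : L * F].
    apply/setP=> c; apply/imset2P/imsetP => [[g y _ _ ->] | [[g y] _ ->]].
      by exists (g, y).
    by exists g y.
  rewrite card_imset => [|[g y] [g' y']]; last exact: ext_codeword_inj.
  by rewrite card_prod cardL -expnSr.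
- have [g g_neq0 cardz] := ext_codeword_many_zeros.
  exists (cw g 0), (cw 0 0); split; rewrite ?C_cw //.
    by apply: contra g_neq0 => /eqP/ext_codeword_inj[->].
  by rewrite bdistE ext_codewordB !subr0 cardz.
move=> _ _ /imset2P[g y _ _ ->] /imset2P[g' y' _ _ ->] neq_c.
rewrite bdistE ext_codewordB leq_sub2l // card_zeros_ext_codeword //.
apply: contra neq_c; rewrite !xpair_eqE !subr_eq0 => /andP[/eqP-> /eqP->].
exact: eqxx.
Qed.

End Code.

(* The bound already fails with the ceilings dropped. *)
Lemma not_bgriesmer_bound (q b k : nat) : (1 < q)%N -> (0 < b)%N -> (b <= k)%N ->
  ~ bgriesmer_bound q b (q ^ k) k.+1 (q ^ k - q ^ (k - b)).+1.
Proof.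
move=> q_gt1 b_gt0 b_le_k; rewrite /bgriesmer_bound; apply/negP; rewrite -ltNge.
have [c [m [-> ->]]] : exists c m, b = c.+1 /\ k = (c.+1 + m)%N.
  by exists b.-1, (k - b)%N; lia.
rewrite addKn /= -natr1 natrB ?leq_exp2l ?leq_addl // !natrX.
set Q : rat := q%:R; have Q_gt1 : 1 < Q by rewrite /Q ltr1n.
set A := Q ^+ c * _.
have Q_neq0 : Q != 0 by rewrite gt_eqF //; lra.
(* Without ceilings the Griesmer sum is geometric of ratio 1/q. *)
have geom j : \sum_(i < j.+1) A / Q ^+ i = A * (Q - Q ^- j) / (Q - 1).
  elim: j => [|j IHj]; first by rewrite big_ord1 expr0; field; lra.
  by rewrite big_ord_recr /= IHj exprS; field; rewrite expf_neq0 // Q_neq0; lra.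
apply: (@lt_le_trans _ _ (\sum_(i < (c.+1 + m).+1) A / Q ^+ i)); last first.
  by apply: ler_sum => i _; exact: ceil_ge.
rewrite geom ltr_pM2r ?invr_gt0; last by lra.
rewrite /A exprD exprS; set u := Q ^+ c; set v := Q ^+ m.
have u_gt0 : 0 < u by apply: exprn_gt0; lra.
have v_ge1 : 1 <= v by apply: exprn_ege1; lra.
rewrite -subr_gt0.
(* Here [Q * u] is q^b, [Q * u * v] is q^k and [v] is q^(k-b). The gap between the two sides,
   multiplied by [Q - 1], splits into a positive term and one that is nonnegative since [v >= 1]. *)
have -> : u * (Q * u * v - v + 1) * (Q - (Q * u * v)^-1) - (Q * u - 1) * (Q * u * v)
   = u * (Q - 1) + u * (v - 1) / (Q * u * v).
  by field; rewrite Q_neq0 !gt_eqF //; lra.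
apply: ltr_pwDl; first by apply: mulr_gt0; lra.
by rewrite divr_ge0 ?mulr_ge0 //; lra.
Qed.

Theorem theorem7 (q b k : nat) (F L : finFieldType)
    (iota : {rmorphism F -> L}) (gamma : {unit L})
    (cardF : #|F| = q) (cardL : #|L| = (q ^ k)%N)
    (b_ge1 : (1 <= b)%N) (k_gt0 : (0 < k)%N) (b_le_k : (b <= k)%N)
    (gamma_primitive : generator [set: {unit L}] gamma) :
  let C := ext_code iota (q ^ k) k (val gamma) in
  is_linear_bcode b k.+1 (q ^ k - q ^ (k - b))%N C /\
  bgriesmer_distance_optimal b k.+1 (q ^ k - q ^ (k - b))%N C.
Proof.
move=> C; have C_bcode : is_linear_bcode b k.+1 (q ^ k - q ^ (k - b))%N C.
  by rewrite -cardF in cardL C *; exact: ext_code_linear_bcode.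
split=> //; split=> //; rewrite cardF; apply: not_bgriesmer_bound => //.
by rewrite -cardF; exact: finNzRing_gt1.
Qed.
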